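(* Consider the rubber Chaplygin ball in $\mathbb R^n$ rolling without slipping and twisting over a fixed $(n-1)$-dimensional sphere, and its $SO(n)$-Chaplygin reduction to $TS^{n-1}\cong\mathcal F^\pm/SO(n)$ (see context). The Lagrange–d'Alembert equations describing the motion $\gamma(t)\in S^{n-1}$ of the reduced system are $$\Big(\epsilon\frac{d}{dt}\big(\mathbf I(\gamma\wedge\dot\gamma)\gamma\big)+(1-\epsilon)\,\mathbf I(\gamma\wedge\dot\gamma)\dot\gamma,\ \xi\Big)=0\qquad\text{for all }\xi\in T_\gamma S^{n-1}.$$
   Context: Vectors of $\mathbb R^n$ are columns, $(x,y)=x^Ty$, $x\wedge y=xy^T-yx^T$. Identify $so(n)\cong so(n)^*$ by $\langle X,Y\rangle=-\frac12\mathrm{tr}(XY)$; $\mathbb E$ is the identity operator on $so(n)$. For $\gamma\in S^{n-1}$, $\mathfrak v_\gamma=\mathbb R^n\wedge\gamma$, $\mathfrak h_\gamma=\mathfrak v_\gamma^\perp$, and $\mathrm{pr}_{\mathfrak h_\gamma}$ is the orthogonal projection of $so(n)$ onto $\mathfrak h_\gamma$. Setting. A ball of radius $\rho>0$, mass $m>0$ and inertia tensor $\mathbb I:so(n)\to so(n)$ (symmetric positive definite), with mass center at its geometric center, rolls over a fixed sphere of radius $\sigma>0$ centered at the origin: sign $+$ for rolling over the outer surface; sign $-$ for rolling over the inner surface ($\sigma>\rho$) or for a spherical shell rolling around the fixed sphere in its interior ($\sigma<\rho$). Put $\epsilon=\frac\sigma{\sigma\pm\rho}$, $D=m\rho^2$,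 $\mathbf I=\mathbb I+D\mathbb E$. The configuration space is the set of $(g,\mathbf r)$, $g\in SO(n)$, $\mathbf r\in\mathbb R^n$ with $(\mathbf r,\mathbf r)=(\sigma\pm\rho)^2$ (a sphere $S^{n-1}$). With $\omega=g^{-1}\dot g$, $\mathbf V=\dot{\mathbf r}$, the Lagrangian is $L=\frac12\langle\mathbb I\omega,\omega\rangle+\frac12m(\mathbf V,\mathbf V)$ and the constraint distribution is $$\mathcal F^\pm=\{(\omega,\mathbf V,g,\mathbf r)\mid\mathbf V=\pm\tfrac\rho{\sigma\pm\rho}\,g\omega g^{-1}\mathbf r,\ \mathrm{pr}_{\mathfrak h_\gamma}\omega=0\},\qquad \gamma=\tfrac1{\sigma\pm\rho}g^{-1}\mathbf r .$$ Motions are the solutions of the Lagrange–d'Alembert equations: curves tangent to $\mathcal F^\pm$ along which $\frac d{dt}\frac{\partial L}{\partial\dot q}-\frac{\partial L}{\partial q}$ annihilates $\mathcal F^\pm$. Everything is invariant under the left $SO(n)$-action $a\cdot(g,\mathbf r)=(ag,a\mathbf r)$, with orbit map $\pi(g,\mathbf r)=\gamma\in S^{n-1}$, and $\mathcal F^\pm$ is a principal connection of the bundle $\pi:SO(n)\times S^{n-1}\to S^{n-1}$. The reduced system is the induced system on $TS^{n-1}\cong\mathcal F^\pm/SO(n)$; its motions are the projections $\gamma(t)=\pi(g(t),\mathbf r(t))$ of motions of the full system. *)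

(* Defs.v *)
From mathcomp Require Import all_boot all_order all_algebra.
From mathcomp Require Import all_classical all_reals all_analysis.

Set Implicit Arguments.
Unset Strict Implicit.
Unset Printing Implicit Defensive.

Import Order.TTheory GRing.Theory Num.Theory.
Import numFieldNormedType.Exports.

Local Open Scope ring_scope.
Local Open Scope classical_set_scope.

Definition dotv (R : realType) (n : nat) (x y : 'cV[R]_n) : R :=
  (x^T *m y) 0 0.

Definition wedgev (R : realType) (n : nat) (x y : 'cV[R]_n) : 'M[R]_n :=
  x *m y^T - y *m x^T.

Definition sphere (R : realType) (n : nat) (a : R) : set 'cV[R]_n :=
  [set x | dotv x x = a ^+ 2].

Definition tangent_sphere (R : realType) (n : nat) (x : 'cV[R]_n) :
  set 'cV[R]_n := [set xi | dotv x xi = 0].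

Definition SO (R : realType) (n : nat) : set 'M[R]_n :=
  [set g | g^T *m g = 1%:M /\ \det g = 1].

Definition so (R : realType) (n : nat) : set 'M[R]_n := [set X | X^T = - X].

Definition pairing (R : realType) (n : nat) (X Y : 'M[R]_n) : R :=
  - (2^-1 * \tr (X *m Y)).

Definition vspc (R : realType) (n : nat) (gamma : 'cV[R]_n) : set 'M[R]_n :=
  range (fun x => wedgev x gamma).

(* The orthogonal complement of [vspc gamma] is taken inside so(n). *)
Definition hspc (R : realType) (n : nat) (gamma : 'cV[R]_n) : set 'M[R]_n :=
  [set X | so X /\ forall Y, vspc gamma Y -> pairing X Y = 0].

(* [is_orthproj W X Y]: Y is the orthogonal projection of X onto the linear
   subspace W. *)
Definition is_orthproj (R : realType) (n : nat) (W : set 'M[R]_n)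
  (X Y : 'M[R]_n) : Prop :=
  W Y /\ forall Z, W Z -> pairing (X - Y) Z = 0.

(* [Inside]: the ball rolls over the inner surface of the fixed sphere;
   [Shell]: the rolling body is a spherical shell enclosing it. *)
Inductive rolling := Outside | Inside | Shell.

Definition rolling_sign (R : realType) (k : rolling) : R :=
  if k is Outside then 1 else -1.

Definition rolling_radii (R : realType) (k : rolling) (rho sigma : R) : Prop :=
  match k with
  | Outside => True
  | Inside => rho < sigma
  | Shell => sigma < rho
  end.

(* The inertia tensor is a linear operator on so(n). It is given as a linear
   operator on all matrices preserving so(n), every operator on so(n) being of
   this form; nothing is assumed of its values outside so(n). *)
Record rubber_ball (R : realType) (n : nat) := RubberBall {
  side : rolling;
  rho : R;
  sigma : R;
  mass : R;
  inertia : {linear 'M[R]_n -> 'M[R]_n};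
  rho_gt0 : 0 < rho;
  sigma_gt0 : 0 < sigma;
  radii_compat : rolling_radii side rho sigma;
  mass_gt0 : 0 < mass;
  inertia_so : forall X, so X -> so (inertia X);
  inertia_sym : forall X Y, so X -> so Y ->
    pairing (inertia X) Y = pairing X (inertia Y);
  inertia_pos : forall X, so X -> X != 0 -> 0 < pairing (inertia X) X
}.

(* The covector d/dt (dL/dq') - dL/dq along a curve q in a vector space,
   evaluated at w. For a curve in a submanifold Q, its value at a vector w
   tangent to Q depends only on the restriction of L to TQ. *)
Definition euler_lagrange (R : realType) (V : normedModType R) (L : V -> V -> R)
  (q : R -> V) (t : R) (w : V) : R :=
  derive1 (fun s => 'D_w (L (q s)) (derive1 q s)) t
  - 'D_w (fun x => L x (derive1 q t)) (q t).

Definition twice_derivable (R : realType) (V : normedModType R)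
  (J : set R) (c : R -> V) :=
  forall t, J t -> derivable c t 1 /\ derivable (derive1 c) t 1.

Section RubberBallSystem.
Context {R : realType} {n : nat} (B : rubber_ball R n).

Definition sgn : R := rolling_sign R (side B).

(* sigma +- rho; negative for a shell *)
Definition sradius : R := sigma B + sgn * rho B.

Definition epsilon : R := sigma B / sradius.

Definition modified_inertia (X : 'M[R]_n) : 'M[R]_n :=
  inertia B X + (mass B * rho B ^+ 2) *: X.

(* The configuration space is a submanifold of the vector space of all pairs
   (g, r), and its tangent vectors are pairs (dg, dr) of the same type. The
   formula of [lagrangian] extends the Lagrangian to all invertible g. *)
Notation ambient := ('M[R]_n * 'cV[R]_n)%type.

Definition configuration : set ambient :=
  [set q | SO q.1 /\ sphere sradius q.2].

Definition angular_velocity (q v : ambient) : 'M[R]_n := invmx q.1 *m v.1.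

Definition tangent_configuration (q : ambient) : set ambient :=
  [set v | so (angular_velocity q v) /\ tangent_sphere q.2 v.2].

Definition proj_sphere (q : ambient) : 'cV[R]_n :=
  sradius^-1 *: (invmx q.1 *m q.2).

Definition constraint_distribution (q : ambient) : set ambient :=
  [set v | [/\ tangent_configuration q v,
     v.2 = (sgn * (rho B / sradius)) *:
             (q.1 *m angular_velocity q v *m invmx q.1 *m q.2) &
     is_orthproj (hspc (proj_sphere q)) (angular_velocity q v) 0]].

Definition lagrangian (q v : ambient) : R :=
  2^-1 * pairing (inertia B (angular_velocity q v)) (angular_velocity q v)
  + 2^-1 * mass B * dotv v.2 v.2.

Definition motion (J : set R) (q : R -> ambient) : Prop :=
  twice_derivable J q /\
  forall t, J t ->
    [/\ configuration (q t),
        constraint_distribution (q t) (derive1 q t) &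
        forall w, constraint_distribution (q t) w ->
          euler_lagrange lagrangian q t w = 0].

Definition reduced_motion (J : set R) (gamma : R -> 'cV[R]_n) : Prop :=
  exists2 q, motion J q & forall t, J t -> proj_sphere (q t) = gamma t.

End RubberBallSystem.

(* Main.v *)
(* The constraint determines the spin from the motion of gamma: writing
   omega = g^-1 g', one has gamma' = - epsilon omega gamma and
   pr_h omega = 0, hence omega = epsilon^-1 gamma /\ gamma'. So motions over
   gamma are exactly the horizontal lifts g' = g omega, r = (sigma +- rho) g gamma
   that satisfy the Lagrange-d'Alembert equations. On the admissible variations
   (g eta, +- rho g xi), eta = xi /\ gamma, the Euler-Lagrange covector is
   <I omega', eta> + <I omega, [eta, omega]> + m (r'', +- rho g xi), which equals
   epsilon^-2 times the pairing of the reduced covector with xi.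
   Conversely a horizontal lift of gamma is a solution of the linear equation
   g' = g omega, which exists on all of J by Picard iteration. *)
Require Import Defs.
From mathcomp Require Import all_boot all_order all_algebra.
From mathcomp Require Import all_classical all_reals all_analysis.
From mathcomp Require Import ring lra.
Import Order.TTheory GRing.Theory Num.Theory.
Import numFieldNormedType.Exports.
Local Open Scope ring_scope.
Local Open Scope classical_set_scope.
Set Implicit Arguments.
Unset Strict Implicit.
Unset Printing Implicit Defensive.

(** * Directional derivatives of matrix-valued maps *)

Section MatrixCalculus.
Context {R : realType} {V : normedModType R}.
Implicit Types (t v : V).

(** Restriction to a line carries results about curves over to directional derivatives on [V];
    [is_derive_invmx] is obtained from [is_derive1_invmx] this way. *)
Lemma is_derive_line (W : normedModType R) (f : V -> W) t v df :
  is_derive t v f df <-> is_derive (0 : R) 1 (fun h : R => f (h *: v + t)) df.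
Proof.
have E : 'D_v f t = 'D_1 (fun h : R => f (h *: v + t)) 0.
  rewrite /derive.
  under [in RHS]eq_fun do rewrite /= addr0 scale0r add0r [_%:A]mulr1.
  by [].
split=> -[d <-]; split=> //.
  exact: (derivable1P f t v).1.
exact: (derivable1P f t v).2.
Qed.

Lemma is_derive_big (W : normedModType R) (I : Type) (r : seq I) (P : pred I)
    (f : I -> V -> W) (df : I -> W) t v :
  (forall i, P i -> is_derive t v (f i) (df i)) ->
  is_derive t v (fun x => \sum_(i <- r | P i) f i x) (\sum_(i <- r | P i) df i).
Proof.
move=> fdf.
have -> : (fun x => \sum_(i <- r | P i) f i x) = \sum_(i <- r | P i) f i.
  by apply/funext => x; rewrite fct_sumE.
elim/big_ind2 : _ => [|x dx y dy|]; last exact: fdf.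
  exact: is_derive_cst.
exact: is_deriveD.
Qed.

Lemma is_derive_scalel (W : normedModType R) (c : R) (g : V -> W) t v dg :
  is_derive t v g dg -> is_derive t v (fun x => c *: g x) (c *: dg).
Proof. by move=> ?; exact: is_deriveZ. Qed.

Lemma is_derive_mxP m n (M : V -> 'M[R]_(m, n)) t v dM :
  is_derive t v M dM <->
  forall i j, is_derive t v (fun x => M x i j) (dM i j).
Proof.
split=> [[d <-] i j|H].
  rewrite derive_mx// mxE; apply: derivableP.
  by have /derivable_mxP := d; apply.
have d : derivable M t v by apply/derivable_mxP => i j; case: (H i j).
split=> //; rewrite derive_mx//; apply/matrixP => i j; rewrite mxE.
by case: (H i j).
Qed.

Lemma is_derive_mulmx m n p (A : V -> 'M[R]_(m, n)) (B : V -> 'M[R]_(n, p))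
    t v dA dB : is_derive t v A dA -> is_derive t v B dB ->
  is_derive t v (fun x => A x *m B x) (dA *m B t + A t *m dB).
Proof.
move=> /is_derive_mxP hA /is_derive_mxP hB; apply/is_derive_mxP => i j.
rewrite !mxE -big_split/=.
under [X in is_derive _ _ X _]eq_fun do rewrite mxE.
apply: is_derive_big => k _; apply: is_derive_eq.
by rewrite addrC; congr (_ + _); exact: mulrC.
Qed.

Lemma is_derive_trmx m n (A : V -> 'M[R]_(m, n)) t v dA :
  is_derive t v A dA -> is_derive t v (fun x => (A x)^T) dA^T.
Proof.
move=> /is_derive_mxP hA; apply/is_derive_mxP => i j; rewrite !mxE.
by under [X in is_derive _ _ X _]eq_fun do rewrite mxE.
Qed.

Lemma is_derive_mxtrace n (A : V -> 'M[R]_n) t v dA :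
  is_derive t v A dA -> is_derive t v (fun x => \tr (A x)) (\tr dA).
Proof. by move=> /is_derive_mxP hA; apply: is_derive_big. Qed.

(** Expanded on the basis [delta_mx i j], each entry of [f (A x)] is a finite combination of entries
    of [A x] with constant coefficients. *)
Lemma is_derive_linear_mx m n p q (f : {linear 'M[R]_(m, n) -> 'M[R]_(p, q)})
    (A : V -> 'M[R]_(m, n)) t v dA :
  is_derive t v A dA -> is_derive t v (fun x => f (A x)) (f dA).
Proof.
move=> /is_derive_mxP hA; apply/is_derive_mxP => k l.
have fE B : f B k l = \sum_i \sum_j f (delta_mx i j) k l * B i j.
  rewrite [in LHS](matrix_sum_delta B) linear_sum summxE.
  apply: eq_bigr => i _; rewrite linear_sum summxE; apply: eq_bigr => j _.
  by rewrite linearZ mxE mulrC.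
rewrite fE; under [X in is_derive _ _ X _]eq_fun do rewrite fE.
apply: is_derive_big => i _; apply: is_derive_big => j _.
Qed.

Lemma is_derive_pairing n (A B : V -> 'M[R]_n) t v dA dB :
  is_derive t v A dA -> is_derive t v B dB ->
  is_derive t v (fun x => pairing (A x) (B x)) (pairing dA (B t) + pairing (A t) dB).
Proof.
move=> hA hB; rewrite /pairing -opprD -mulrDr -mxtraceD.
apply: is_deriveN; apply: (@is_derive_scalel R^o 2^-1).
apply: is_derive_mxtrace; exact: is_derive_mulmx.
Qed.

Lemma is_derive_dotv n (x y : V -> 'cV[R]_n) t v dx dy :
  is_derive t v x dx -> is_derive t v y dy ->
  is_derive t v (fun s => dotv (x s) (y s)) (dotv dx (y t) + dotv (x t) dy).
Proof.
move=> hx hy; have := is_derive_mulmx (is_derive_trmx hx) hy.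
by move=> /is_derive_mxP /(_ 0 0); rewrite mxE.
Qed.

Lemma derivable_prod (I : Type) (r : seq I) (P : pred I) (f : I -> V -> R) t v :
  (forall i, P i -> derivable (f i) t v) ->
  derivable (fun x => \prod_(i <- r | P i) f i x) t v.
Proof.
move=> fP; elim: r => [|i r IH].
  under eq_fun do rewrite big_nil; exact: derivable_cst.
under eq_fun do rewrite big_cons.
case: ifPn => Pi; last exact: IH.
exact: derivableM (fP i Pi) IH.
Qed.

Lemma derivable_det n (A : V -> 'M[R]_n) t v :
  derivable A t v -> derivable (fun x => \det (A x)) t v.
Proof.
move=> /derivable_mxP hA; rewrite /determinant.
apply: ex_derive; apply: is_derive_big => s _; apply: derivableP.
by apply: derivableM; [exact: derivable_cst|exact: derivable_prod].
Qed.

End MatrixCalculus.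

(** * Inverses along curves of matrices *)

Section Curves.
Context {R : realType}.

Lemma derivable_continuous (W : normedModType R) (f : R -> W) t :
  derivable f t 1 -> {for t, continuous f}.
Proof. by move=> /derivable1_diffP/differentiable_continuous. Qed.

Lemma near_unitmx n (A : R -> 'M[R]_n) t :
  derivable A t 1 -> A t \in unitmx -> \forall s \near t, A s \in unitmx.
Proof.
move=> dA; rewrite unitmxE unitfE => A0.
have /derivable_continuous dc := derivable_det dA.
near=> s; rewrite unitmxE unitfE; near: s.
exact: (cvgr_neq0 _ dc A0).
Unshelve. all: by end_near. Qed.

(** Cramer's rule: near [t] the inverse is the adjugate over the determinant, and cofactors are
    signed determinants of submatrices. *)
Lemma derivable_invmx n (A : R -> 'M[R]_n) t :
  derivable A t 1 -> A t \in unitmx -> derivable (fun s => invmx (A s)) t 1.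
Proof.
move=> dA At; have /derivable_mxP dAij := dA.
apply: (@near_eq_derivable _ _ _ (fun s => (\det (A s))^-1 *: \adj (A s))).
  near=> s; rewrite /invmx ifT//; near: s; exact: near_unitmx.
apply/derivable_mxP => i j; under eq_fun do rewrite !mxE.
apply: derivableM.
  apply: derivableV; first by rewrite -unitfE -unitmxE.
  exact: derivable_det.
rewrite /cofactor; apply: derivableM; first exact: derivable_cst.
apply: derivable_det; apply/derivable_mxP => k l.
rewrite (_ : (fun x => _) = (fun x => A x (lift j k) (lift i l))); first exact: dAij.
by apply/funext => x; rewrite !mxE.
Unshelve. all: by end_near. Qed.

(** Derivability being known, the value comes from differentiating [invmx (A s) *m A s = 1], valid
    near [t], and solving for the unknown factor. *)
Lemma is_derive1_invmx n (A : R -> 'M[R]_n) t dA :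
  is_derive (t : R) (1 : R) A dA -> A t \in unitmx ->
  is_derive t (1 : R) (fun s => invmx (A s)) (- (invmx (A t) *m dA *m invmx (A t))).
Proof.
move=> hA At; have dA' : derivable A t 1 by case: hA.
have hI := derivableP (derivable_invmx dA' At).
have h1 := is_derive_mulmx hI hA.
have h2 : is_derive t (1 : R) (fun s => invmx (A s) *m A s) 0.
  apply: (near_eq_is_derive _ (is_derive_cst (1%:M : 'M[R]_n) t 1)).
  by near=> s; rewrite mulVmx//; near: s; exact: near_unitmx.
apply: (is_derive_eq hI).
have /eqP := @derive_val _ _ _ _ _ _ _ h1.
rewrite (@derive_val _ _ _ _ _ _ _ h2) eq_sym addr_eq0 => /eqP e.
by rewrite -[LHS]mulmx1 -(mulmxV At) mulmxA e mulNmx.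
Unshelve. all: by end_near. Qed.

End Curves.

(** * Derivatives of pairs, inverses and wedge products *)

Section Pairs.
Context {R : realType} {V : normedModType R}.
Implicit Types (t v : V).

Lemma is_derive_cvgP (W : normedModType R) (f : V -> W) t v df :
  is_derive t v f df <-> h^-1 *: (f (h *: v + t) - f t) @[h --> (0 : R)^'] --> df.
Proof.
split=> [[d <-]|c]; first exact: d.
by split; [apply/cvg_ex; exists df|exact: cvg_lim].
Qed.

Lemma is_derive_pair (W1 W2 : normedModType R) (f : V -> W1) (g : V -> W2) t v df dg :
  is_derive t v f df -> is_derive t v g dg ->
  is_derive t v (fun x => (f x, g x)) (df, dg).
Proof.
move=> /is_derive_cvgP hf /is_derive_cvgP hg; apply/is_derive_cvgP.
exact: cvg_pair hf hg.
Qed.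

Lemma is_derive_fst (W1 W2 : normedModType R) (f : V -> W1 * W2) t v df :
  is_derive t v f df -> is_derive t v (fun x => (f x).1) df.1.
Proof.
move=> /is_derive_cvgP hf; apply/is_derive_cvgP.
exact: cvg_comp hf cvg_fst.
Qed.

Lemma is_derive_snd (W1 W2 : normedModType R) (f : V -> W1 * W2) t v df :
  is_derive t v f df -> is_derive t v (fun x => (f x).2) df.2.
Proof.
move=> /is_derive_cvgP hf; apply/is_derive_cvgP.
exact: cvg_comp hf cvg_snd.
Qed.

Lemma is_derive_invmx n (A : V -> 'M[R]_n) t v dA :
  is_derive t v A dA -> A t \in unitmx ->
  is_derive t v (fun x => invmx (A x)) (- (invmx (A t) *m dA *m invmx (A t))).
Proof.
move=> /is_derive_line hA At; apply/is_derive_line.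
have := is_derive1_invmx hA; rewrite scale0r add0r; exact.
Qed.

Lemma is_derive_wedgev n (x y : V -> 'cV[R]_n) t v dx dy :
  is_derive t v x dx -> is_derive t v y dy ->
  is_derive t v (fun s => wedgev (x s) (y s)) (wedgev dx (y t) + wedgev (x t) dy).
Proof.
move=> hx hy.
have h1 := is_derive_mulmx hx (is_derive_trmx hy).
have h2 := is_derive_mulmx hy (is_derive_trmx hx).
apply: (is_derive_eq (is_deriveB h1 h2)).
by rewrite /wedgev opprD (addrC (- (dy *m _))) addrACA.
Qed.

End Pairs.

(** * Mean value inequalities and geometric series *)

Section RealFunctions.
Context {R : realType}.
Implicit Types (f df phi dphi : R -> R) (x y t : R).

Lemma continuous_within_segment f x y :
  (forall z, x <= z <= y -> {for z, continuous f}) ->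
  {within `[x, y], continuous f}.
Proof.
move=> fc; apply: continuous_in_subspaceT => z /set_mem /=.
by rewrite in_itv/= => /fc.
Qed.

Lemma le_increment f df phi dphi x y : x <= y ->
  (forall z, x <= z <= y -> is_derive z 1 f (df z)) ->
  (forall z, x <= z <= y -> is_derive z 1 phi (dphi z)) ->
  (forall z, x <= z <= y -> `|df z| <= dphi z) ->
  `|f y - f x| <= phi y - phi x.
Proof.
move=> xy hf hphi hle.
have key (s : R) : `|s| = 1 -> s * (f y - f x) <= phi y - phi x.
  move=> s1; pose h z := phi z - s * f z; pose dh z := dphi z - s * df z.
  have hh z : x <= z <= y -> is_derive z 1 h (dh z).
    move=> zxy; apply: is_deriveB; first exact: hphi.
    by apply: is_deriveZ; exact: hf.
  have [||c] := @MVT_segment R h dh x y xy.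
  - by move=> z; rewrite in_itv/= => /andP[/ltW xz /ltW zy]; apply: hh; rewrite xz.
  - apply: continuous_within_segment => z /hh[d _].
    exact: derivable_continuous.
  rewrite in_itv/= => cxy hE.
  have : 0 <= h y - h x.
    rewrite hE mulr_ge0 ?subr_ge0// (le_trans _ (hle _ cxy))//.
    by rewrite -[leRHS]mul1r -s1 -normrM ler_norm.
  by rewrite /h; lra.
have := key 1 (normr1 _); have := key (-1) (normrN1 _).
by rewrite ler_norml; lra.
Qed.

Lemma derive0_constant f x y : x <= y ->
  (forall z, x <= z <= y -> is_derive z 1 f 0) -> f y = f x.
Proof.
move=> xy hf; have : `|f y - f x| <= cst 0 y - cst 0 x :> R.
  apply: (@le_increment f (cst 0) (cst 0) (cst 0)) => // z _.
  by rewrite normr0.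
by rewrite subrr normr_le0 subr_eq0 => /eqP.
Qed.

(** Free of an order between [x] and [y], this serves Picard estimates on both sides of the initial
    time. *)
Lemma le_increment_norm f df phi dphi (c d x y : R) :
  (forall z, c <= z <= d -> is_derive z 1 f (df z)) ->
  (forall z, c <= z <= d -> is_derive z 1 phi (dphi z)) ->
  (forall z, c <= z <= d -> `|df z| <= dphi z) ->
  c <= x <= d -> c <= y <= d -> `|f y - f x| <= `|phi y - phi x|.
Proof.
move=> hf hphi hle /andP[cx xd] /andP[cy yd].
wlog xy : x y cx xd cy yd / x <= y.
  move=> H; have [xy|/ltW yx] := leP x y; first exact: H.
  by rewrite distrC (distrC (phi y)); exact: H.
apply: le_trans (ler_norm _); apply: (@le_increment f df phi dphi) => // z /andP[xz zy].
- by apply: hf; rewrite (le_trans cx)// (le_trans zy).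
- by apply: hphi; rewrite (le_trans cx)// (le_trans zy).
- by apply: hle; rewrite (le_trans cx)// (le_trans zy).
Qed.

Lemma near_between (c t d : R) : c < t < d -> \forall s \near t, c < s < d.
Proof.
move=> ctd; have := @near_in_itvoo R c d t; rewrite in_itv/= ctd => /(_ isT).
by apply: filterS => s; rewrite in_itv.
Qed.

Lemma continuous_sum_at (I : Type) (r : seq I) (f : I -> R -> R) t :
  (forall i, {for t, continuous (f i)}) ->
  {for t, continuous (fun s => \sum_(i <- r) f i s)}.
Proof.
move=> fc; elim: r => [|i r IH].
  under [X in {for _, continuous X}]eq_fun do rewrite big_nil.
  exact: cvg_cst.
under [X in {for _, continuous X}]eq_fun do rewrite big_cons.
exact: cvgD (fc i) IH.
Qed.

Lemma geometric_bound_series (u : nat -> R) (M : R) :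
  (forall k, `|u k| <= M / 2 ^+ k) ->
  forall K, `|limn (series u) - \sum_(k < K) u k| <= 2 * M / 2 ^+ K.
Proof.
move=> uM.
have M0 : 0 <= M by have := uM 0; rewrite expr0 divr1; exact: le_trans.
have h0 k : 0 <= M / 2 ^+ k :> R by rewrite divr_ge0// exprn_ge0.
have ucvg : cvgn (series u).
  apply: normed_cvg.
  apply: (@series_le_cvg _ _ (geometric M 2^-1)) => //.
  - exact: (fun k => normr_ge0 (u k)).
  - by move=> k /=; rewrite exprVn.
  - by move=> k /=; rewrite exprVn.
  - by apply: is_cvg_geometric_series; rewrite ger0_norm ?invr_ge0//; lra.
(* The right side is the exact geometric sum of the bounds, kept in telescoping form for the
   induction on [m]; afterwards [m] goes to infinity. *)
have tail K m : `|\sum_(k < K + m) u k - \sum_(k < K) u k| <=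
    2 * M * (1 / 2 ^+ K - 1 / 2 ^+ (K + m)).
  elim: m => [|m IH]; first by rewrite addn0 !subrr normr0 mulr0.
  rewrite addnS big_ord_recr/= addrAC (le_trans (ler_normD _ _))//.
  rewrite (le_trans (lerD IH (uM _)))// exprS invfM.
  have := h0 (K + m); set z := (2 ^+ (K + m))^-1; lra.
move=> K.
have c1 : (fun m => `|series u m - \sum_(k < K) u k|) @ \oo -->
    `|limn (series u) - \sum_(k < K) u k|.
  by apply: cvg_norm; apply: cvgB; [exact: ucvg|exact: cvg_cst].
apply: (cvgr_to_le c1); near=> m.
have Km : (K <= m)%N by near: m; exists K.
rewrite seriesEord/= -(subnKC Km) (le_trans (tail _ _))//.
rewrite mulrBr mulrA mulr1 lerBlDr lerDl mulr_ge0// ?divr_ge0 ?exprn_ge0//.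
by rewrite mulr_ge0.
Unshelve. all: by end_near. Qed.

Lemma small_half_power (M e : R) : 0 < e -> exists K, M / 2 ^+ K <= e.
Proof.
move=> e0.
have /cvgrPdist_le /(_ e e0) : geometric M (2^-1 : R) @ \oo --> 0.
  by apply: cvg_geometric; rewrite ger0_norm ?invr_ge0//; lra.
case=> K _ /(_ K (leqnn K)) /=; rewrite sub0r normrN exprVn => h.
by exists K; exact: le_trans (ler_norm _) h.
Qed.

Lemma half_power_bound0 (M x : R) : (forall K, `|x| <= M / 2 ^+ K) -> x = 0.
Proof.
move=> xM; apply/normr0_eq0/eqP; rewrite eq_le normr_ge0 andbT.
apply/ler_addgt0Pr => e e0; rewrite add0r.
by have [K] := small_half_power M e0; exact: le_trans (xM K).
Qed.

End RealFunctions.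

(** * Connectedness of the time interval *)

Section Interval.
Context {R : realType} {J : set R} (Jitv : is_interval J).

Lemma segment_in_interval c d z : J c -> J d -> c <= z <= d -> J z.
Proof. by move=> Jc Jd; exact: Jitv Jc Jd _. Qed.

Lemma constant_on_interval (f : R -> R) x y : J x -> J y ->
  (forall z, J z -> is_derive z 1 f 0) -> f y = f x.
Proof.
move=> Jx Jy hf; have [xy|/ltW yx] := leP x y; [|symmetry];
  apply: derive0_constant => // z zxy; apply: hf;
  exact: segment_in_interval zxy.
Qed.

Lemma interval_IVT (f : R -> R) x y v : (forall t, J t -> {for t, continuous f}) ->
  J x -> J y -> f x <= v <= f y -> exists2 u, J u & f u = v.
Proof.
move=> fc Jx Jy /andP[xv vy].
have Jmin : J (Num.min x y) by rewrite minEle; case: ifP.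
have Jmax : J (Num.max x y) by rewrite maxEle; case: ifP.
have mm : Num.min x y <= Num.max x y by rewrite ge_min le_max lexx.
have [||u] := @IVT R f _ _ v mm.
- apply: continuous_within_segment => z zm; apply: fc.
  exact: segment_in_interval zm.
- by case: (leP x y) => _; rewrite ge_min le_max xv vy ?orbT.
- rewrite in_itv/= => um fu; exists u => //.
  exact: segment_in_interval um.
Qed.

End Interval.

(** * Global solutions of linear matrix differential equations *)

Section LinearODE.
Context {R : realType} {J : set R} (Jopen : open J) (Jitv : is_interval J).
Context {t0 : R} (Jt0 : J t0).

Lemma interval_around x : J x -> exists c d, [/\ J c, J d & c < x < d].
Proof.
move=> Jx; have /nbhs_ballP[e /= e0 be] : nbhs x J by exact: open_nbhs_nbhs.
exists (x - e / 2), (x + e / 2); split; [apply: be|apply: be|lra].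
- by rewrite /ball/= opprB addrC subrK ger0_norm; lra.
- by rewrite /ball/= opprD addNKr normrN ger0_norm; lra.
Qed.

Lemma interval_around2 x y : J x -> J y ->
  exists c d, [/\ J c, J d, c < x < d & c < y < d].
Proof.
move=> /interval_around[c [d [Jc Jd cxd]]] /interval_around[c' [d' [Jc' Jd' cyd]]].
exists (Num.min c c'), (Num.max d d'); split.
- by rewrite minEle; case: ifP.
- by rewrite maxEle; case: ifP.
- by rewrite gt_min lt_max; case/andP: cxd => -> ->.
- by rewrite gt_min lt_max; case/andP: cyd => -> ->; rewrite !orbT.
Qed.

Let continuousJ (f : R -> R) := forall t, J t -> {for t, continuous f}.

(** The fundamental theorem of calculus applies to the integral from [c]; two-sided derivatives are
    claimed only strictly inside the segment. *)
Lemma local_antiderivative f c d : continuousJ f -> J c -> J d -> c <= d ->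
  exists G : R -> R, forall z, c < z < d -> is_derive z 1 G (f z).
Proof.
move=> fc Jc Jd cd.
exists (fun x => \int[lebesgue_measure]_(t in `[c, x]) f t)%R => z /andP[cz zd].
have fi : lebesgue_measure.-integrable `[c, d] (EFin \o f).
  apply: continuous_compact_integrable; first exact: segment_compact.
  apply: continuous_within_segment => x xcd; apply: fc.
  exact: (segment_in_interval Jitv Jc Jd).
have [|d' dE] := continuous_FTC1_closed zd fi cz _.
  by apply: fc; apply: (@segment_in_interval _ _ Jitv c d) => //; rewrite !ltW.
by split; [exact: d'|rewrite -derive1E].
Qed.

(** Local primitives normalized to vanish at [t0] agree wherever two of them are defined, so they
    glue to one function on [J]. *)
Lemma antiderivative f : continuousJ f ->
  exists F : R -> R, F t0 = 0 /\ forall t, J t -> is_derive t 1 F (f t).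
Proof.
move=> fc.
pose P (x y : R) := exists (c d : R) (G : R -> R),
  [/\ J c /\ J d, c < t0 < d, c < x < d,
  (forall z, c < z < d -> is_derive z 1 G (f z)) & y = G x - G t0].
have Pex x : J x -> exists y, P x y.
  move=> Jx; have [c [d [Jc Jd ct0 cx]]] := interval_around2 Jt0 Jx.
  have [|G GP] := local_antiderivative fc Jc Jd.
    by case/andP: cx => /ltW cx /ltW; exact: le_trans.
  by exists (G x - G t0), c, d, G.
have Puniq x y y' : P x y -> P x y' -> y = y'.
  move=> [c [d [G [_ /andP[ct td] /andP[cx xd] GP ->]]]].
  move=> [c' [d' [G' [_ /andP[ct' td'] /andP[cx' xd'] GP' ->]]]].
  have H z : c < z < d -> c' < z < d' -> is_derive z 1 (G - G') 0.
    by move=> h h'; rewrite -(subrr (f z)); apply: is_deriveB; [exact: GP|exact: GP'].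
  suff : (G - G') x = (G - G') t0 by rewrite /= !fctE; lra.
  have [xt|/ltW tx] := leP x t0; [symmetry|];
    apply: derive0_constant => // z /andP[h1 h2]; apply: H; lra.
(* By [Pex] the default 0 is never taken on [J]; [Puniq] makes the chosen value independent of the
   segment and of the primitive. *)
pose F x := xget 0 (P x).
have FP x : J x -> P x (F x) by move=> /Pex[y]; exact: xgetI.
exists F; split.
  by have [c [d [G [_ _ _ _ ->]]]] := FP _ Jt0; rewrite subrr.
move=> t Jt; have [c [d [G [[Jc Jd] ct0 ct GP _]]]] := FP _ Jt.
have dG : is_derive t 1 (fun x => G x - G t0) (f t).
  by rewrite -[f t]subr0; apply: is_deriveB; exact: GP.
apply: (near_eq_is_derive _ dG); near=> x.
have cx : c < x < d by near: x; exact: near_between.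
apply: (Puniq x); first by exists c, d, G.
apply: FP; apply: (@segment_in_interval _ _ Jitv c d) => //.
by case/andP: cx => /ltW-> /ltW->.
Unshelve. all: by end_near. Qed.

(** The solution is the sum of the iterated integrals [X k]. Geometric bounds make it a uniform
    limit on segments, hence continuous. It then satisfies the integral equation, from which the
    derivative is read off without termwise differentiation of the infinite series. *)
Theorem linear_ode n (om : R -> 'M[R]_n) :
  (forall i j, continuousJ (fun t => om t i j)) ->
  exists g : R -> 'M[R]_n,
    g t0 = 1%:M /\ forall t, J t -> is_derive t 1 g (g t *m om t).
Proof.
move=> omc; pose cM (Y : R -> 'M[R]_n) := forall i j, continuousJ (fun t => Y t i j).
(* [choice] requires a value for every function; a discontinuous [f] is sent to itself. *)
have [A AP] : exists A : (R -> R) -> R -> R, forall f, continuousJ f ->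
    A f t0 = 0 /\ forall t, J t -> is_derive t 1 (A f) (f t).
  have : forall f : R -> R, exists F : R -> R, continuousJ f ->
      F t0 = 0 /\ forall t, J t -> is_derive t 1 F (f t).
    move=> f; have [fc|nfc] := pselect (continuousJ f); last by exists f.
    by have [F ?] := antiderivative fc; exists F.
  by move=> /choice[A]; exists A.
pose X k : R -> 'M[R]_n := iter k
  (fun Y t => \matrix_(i, j) A (fun s => (Y s *m om s) i j) t) (cst 1%:M).
pose S K (t : R) i j := \sum_(k < K) X k t i j.
have cmul Y : cM Y -> forall i j, continuousJ (fun s => (Y s *m om s) i j).
  move=> Yc i j t Jt; under [X in {for _, continuous X}]eq_fun do rewrite mxE.
  by apply: continuous_sum_at => k; apply: cvgM; [exact: Yc|exact: omc].
have dA Y : cM Y -> forall i j t, J t ->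
    is_derive t 1 (A (fun s => (Y s *m om s) i j)) ((Y t *m om t) i j).
  by move=> Yc i j; have [] := AP _ (cmul _ Yc i j).
have XS k t i j : X k.+1 t i j = A (fun s => (X k s *m om s) i j) t.
  by rewrite mxE.
have Xc k : cM (X k).
  elim: k => [|k IH] i j t Jt; first exact: cvg_cst.
  under [X in {for _, continuous X}]eq_fun do rewrite XS.
  by apply: derivable_continuous; case: (dA _ IH i j _ Jt).
have dX k i j t : J t -> is_derive t 1 (fun s => X k.+1 s i j) ((X k t *m om t) i j).
  by move=> Jt; under [X in is_derive _ _ X _]eq_fun do rewrite XS; exact: dA.
have X0 k i j : X k.+1 t0 i j = 0.
  by rewrite XS; have [] := AP _ (cmul _ (Xc k) i j).
have ombound (c d : R) : J c -> J d -> c <= d ->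
    exists2 L, 0 <= L & forall i j t, c <= t <= d -> `|om t i j| <= L.
  move=> Jc Jd cd.
  have Lij i j : exists L, forall t, c <= t <= d -> `|om t i j| <= L.
    have [|x _ xP] := @EVT_max _ (fun t => `|om t i j|) c d cd.
      apply: continuous_within_segment => z zcd; apply: cvg_norm.
      exact/omc/(segment_in_interval Jitv Jc Jd).
    by exists `|om x i j| => t tcd; apply: xP; rewrite in_itv.
  have [L LP] : exists L : 'I_n * 'I_n -> R, forall ij t, c <= t <= d ->
      `|om t ij.1 ij.2| <= L ij.
    have : forall ij : 'I_n * 'I_n, exists L, forall t, c <= t <= d ->
      `|om t ij.1 ij.2| <= L by move=> ij; exact: Lij.
    by move=> /choice[L]; exists L.
  (* The sum of the bounds of the single entries is a bound common to all entries. *)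
  exists (\sum_ij `|L ij|) => [|i j t tcd]; first exact: sumr_ge0.
  rewrite (le_trans (LP (i, j) t tcd))// (le_trans (ler_norm _))//.
  by rewrite (bigD1 (i, j))//= lerDl sumr_ge0.
have mulbound (Y W : 'M[R]_n) a b i j : 0 <= b -> (forall l, `|Y i l| <= a) ->
    (forall l, `|W l j| <= b) -> `|(Y *m W) i j| <= n%:R * b * a.
  move=> b0 Ya Wb; rewrite mxE (le_trans (ler_norm_sum _ _ _))//.
  apply: (@le_trans _ _ (\sum_(l < n) b * a)); last first.
    by rewrite sumr_const card_ord -mulrA mulr_natl.
  by apply: ler_sum => l _; rewrite normrM mulrC ler_pM.
have Xbound (c d : R) : J c -> J d -> c <= t0 <= d ->
    exists M, forall k i j t, c <= t <= d -> `|X k t i j| <= M / 2 ^+ k.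
  move=> Jc Jd t0cd; have /andP[ct td] := t0cd.
  have [L L0 LP] := ombound _ _ Jc Jd (le_trans ct td).
  pose C := n%:R * L; have C0 : 0 <= C by rewrite mulr_ge0.
  pose u (t : R) := 2 * C * (t - t0).
  pose psi t := expR (u t) + expR (- u t).
  pose phi t := expR (u t) - expR (- u t).
  have du (t : R) : is_derive t 1 u (2 * C).
    have h : is_derive t 1 (fun s : R => s - t0) 1.
      by rewrite -[X in is_derive _ _ _ X]subr0; apply: is_deriveB.
    by apply: (is_derive_eq (is_deriveZ (2 * C) h)); exact: mulr1.
  have dphi (t : R) : is_derive t 1 phi (2 * C * psi t).
    have h1 := is_derive1_comp (is_derive_expR (u t)) (du t).
    have dNu : is_derive t 1 (fun s => - u s) (- (2 * C)) by exact: is_deriveN.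
    have h2 := @is_derive1_comp R expR (fun s => - u s) t _ _ (is_derive_expR _) dNu.
    apply: (is_derive_eq (is_deriveB h1 h2)).
    by rewrite /psi; ring.
  have psi1 (t : R) : 1 <= psi t.
    by rewrite /psi; have := expR_ge1Dx (u t); have := expR_ge1Dx (- u t); lra.
  have phipsi (t : R) : `|phi t| <= psi t.
    by rewrite (le_trans (ler_normB _ _))// !ger0_norm ?expR_ge0.
  (* The weight psi = 2 cosh(2C(t - t0)) makes the Picard increments decay
     geometrically: |X_(k+1)'| <= C psi / 2^k is the derivative of phi / 2^(k+1). *)
  have Xpsi k i j t : c <= t <= d -> `|X k t i j| <= psi t / 2 ^+ k.
    elim: k i j t => [|k IH] i j t tcd.
      rewrite expr0 divr1 (le_trans _ (psi1 t))// mxE.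
      by case: eqP; rewrite ?normr1 ?normr0.
    have -> : X k.+1 t i j = X k.+1 t i j - X k.+1 t0 i j by rewrite X0 subr0.
    pose ph z := (2 ^+ k.+1)^-1 * phi z.
    apply: (@le_trans _ _ `|ph t - ph t0|).
      apply: (@le_increment_norm _ (fun s => X k.+1 s i j)
        (fun s => (X k s *m om s) i j) ph
        (fun s => (2 ^+ k.+1)^-1 * (2 * C * psi s)) c d) => // z zcd.
      - exact/dX/(segment_in_interval Jitv Jc Jd).
      - have := mulbound (X k z) (om z) (psi z / 2 ^+ k) L i j L0.
        move=> /(_ (fun l => IH _ _ _ zcd) (fun l => LP _ _ _ zcd)).
        move=> /le_trans; apply; rewrite exprS invfM -/C.
        by set y := (2 ^+ k)^-1; lra.
    rewrite /ph /phi /u subrr mulr0 oppr0 subrr mulr0 subr0 normrM mulrC.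
    rewrite [X in _ * X]ger0_norm ?invr_ge0 ?exprn_ge0//.
    by rewrite ler_wpM2r ?invr_ge0 ?exprn_ge0// phipsi.
  (* This bounds [psi] on the whole segment, since both [t - t0] and [t0 - t] are at most
     [d - c]. *)
  exists (2 * expR (2 * C * (d - c))) => k i j t tcd.
  rewrite (le_trans (Xpsi _ _ _ _ tcd))// ler_wpM2r ?invr_ge0 ?exprn_ge0//.
  have /andP[ct' td'] := tcd.
  have h1 : expR (u t) <= expR (2 * C * (d - c)).
    by rewrite ler_expR /u ler_wpM2l ?mulr_ge0//; lra.
  have h2 : expR (- u t) <= expR (2 * C * (d - c)).
    by rewrite ler_expR /u -mulrN ler_wpM2l ?mulr_ge0//; lra.
  by rewrite /psi; lra.
pose g t : 'M[R]_n := \matrix_(i, j) limn (series (fun k => X k t i j)).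
have gS (c d : R) : J c -> J d -> c <= t0 <= d -> exists M, forall t, c <= t <= d ->
    forall K i j, `|g t i j - S K t i j| <= M / 2 ^+ K.
  move=> Jc Jd t0cd; have [M MP] := Xbound _ _ Jc Jd t0cd.
  exists (2 * M) => t tcd K i j; rewrite mxE.
  by apply: geometric_bound_series => k; exact: MP.
have gc : cM g.
  move=> i j t Jt; have [c [d [Jc Jd /andP[ct0 t0d] ctd]]] := interval_around2 Jt0 Jt.
  have [|M MP] := gS _ _ Jc Jd; first by rewrite !ltW.
  have tcd : c <= t <= d by case/andP: ctd => /ltW-> /ltW->.
  apply/cvgrPdist_le => e e0.
  (* The usual three-term estimate: [g] is within [e / 3] of the partial sum [S K] at both times,
     and [S K] is continuous. *)
  have e3 : 0 < e / 3 by rewrite divr_gt0.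
  have [K KP] := small_half_power M e3.
  have Sc : {for t, continuous (fun s => S K s i j)}.
    by apply: continuous_sum_at => k; exact: Xc.
  have Snear : \forall s \near t, `|S K t i j - S K s i j| <= e / 3.
    by move/cvgrPdist_le : Sc; apply.
  near=> s.
  have scd : c <= s <= d.
    have : c < s < d by near: s; exact: near_between.
    by move=> /andP[/ltW-> /ltW->].
  have h1 := le_trans (MP _ tcd K i j) KP.
  have h2 := le_trans (MP _ scd K i j) KP.
  have h3 : `|S K t i j - S K s i j| <= e / 3.
    by near: s; exact: Snear.
  move: h1 h2 h3; rewrite !ler_norml; lra.
have gt0 i j : g t0 i j = (1%:M : 'M[R]_n) i j.
  have [c [d [Jc Jd /andP[ct0 t0d]]]] := interval_around Jt0.
  have t0cd : c <= t0 <= d by rewrite !ltW.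
  have [M MP] := gS _ _ Jc Jd t0cd.
  (* Only the term of index 0 survives at [t0]. The index [K.+1] guarantees that this term is
     present and accounts for the extra factor 1/2. *)
  apply/eqP; rewrite -subr_eq0; apply/eqP/(@half_power_bound0 _ (M / 2)) => K.
  have := MP _ t0cd K.+1 i j; rewrite /S big_ord_recl/= big1 => [|k _]; last exact: X0.
  by rewrite addr0 exprS invfM mulrA.
exists g; split; first by apply/matrixP => i j; exact: gt0.
move=> t Jt; apply/is_derive_mxP => i j.
pose H := A (fun s => (g s *m om s) i j).
have dH (s : R) : J s -> is_derive s 1 H ((g s *m om s) i j) by exact: dA.
have H0 : H t0 = 0 by have [] := AP _ (cmul _ gc i j).
(* This is the integral equation, [H] being the primitive of the entry of [g *m om]. *)
have gH x : J x -> g x i j = H x + (1%:M : 'M[R]_n) i j.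
  move=> Jx.
  have [c [d [Jc Jd /andP[ct0 t0d] /andP[cx xd]]]] := interval_around2 Jt0 Jx.
  have t0cd : c <= t0 <= d by rewrite !ltW.
  have xcd : c <= x <= d by rewrite !ltW.
  have cd : c <= d by case/andP: xcd; exact: le_trans.
  have [M MP] := gS _ _ Jc Jd t0cd.
  have [L L0 LP] := ombound _ _ Jc Jd cd.
  have M0 K : 0 <= M / 2 ^+ K by have := MP _ xcd K i j; exact: le_trans.
  apply/eqP; rewrite -subr_eq0; apply/eqP.
  (* The first term bounds the distance from [g] to [S K.+1]. The second bounds the variation of
     [S K.+1 - H] between [t0] and [x]: its derivative is the entry of [(S K - g) *m om], the index
     dropping by one because differentiation turns [X k.+1] into [X k *m om]. *)
  apply: (@half_power_bound0 _ (M + n%:R * L * M * (d - c))) => K.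
  pose f s := S K.+1 s i j - H s.
  have SE s : S K.+1 s i j = (1%:M : 'M[R]_n) i j + \sum_(k < K) X k.+1 s i j.
    by rewrite /S big_ord_recl.
  pose df s := \sum_(k < K) (X k s *m om s) i j - (g s *m om s) i j.
  have df_f (s : R) : c <= s <= d -> is_derive s 1 f (df s).
    move=> scd; have Js := segment_in_interval Jitv Jc Jd scd.
    apply: is_deriveB; last exact: dH.
    under [X in is_derive _ _ X _]eq_fun do rewrite SE.
    rewrite -[X in is_derive _ _ _ X]add0r; apply: is_deriveD.
    by apply: is_derive_big => k _; exact: dX.
  have df_le s : c <= s <= d -> `|df s| <= n%:R * L * (M / 2 ^+ K).
    move=> scd; have -> : df s = ((\matrix_(i, j) S K s i j - g s) *m om s) i j.
      rewrite mulmxBl [RHS]mxE [X in _ = _ + X]mxE /df; congr (_ - _).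
      rewrite [RHS]mxE; under eq_bigr do rewrite mxE.
      rewrite exchange_big/=; apply: eq_bigr => l _.
      by rewrite mxE mulr_suml.
    apply: mulbound => // l; last exact: LP.
    by have := MP _ scd K i l; rewrite !mxE distrC.
  pose ph (s : R) := n%:R * L * (M / 2 ^+ K) * s.
  have : `|f x - f t0| <= `|ph x - ph t0|.
    apply: (@le_increment_norm _ f df ph
      (fun=> n%:R * L * (M / 2 ^+ K)) c d) => // z zcd.
    by apply: (is_derive_eq (is_deriveZ _ (is_derive_id _ _))); exact: mulr1.
  have -> : f t0 = (1%:M : 'M[R]_n) i j.
    by rewrite /f H0 subr0 SE big1 ?addr0// => k _; exact: X0.
  have Q0 : 0 <= n%:R * L * (M / 2 ^+ K).
    by apply: mulr_ge0; [exact: mulr_ge0|exact: M0].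
  rewrite /ph -mulrBr normrM (ger0_norm Q0).
  have : `|x - t0| <= d - c by rewrite ler_norml; lra.
  have := MP _ xcd K.+1 i j.
  have : M / 2 ^+ K.+1 <= M / 2 ^+ K.
    by have := M0 K; rewrite exprS invfM; set z := (2 ^+ K)^-1; lra.
  have := M0 K.
  rewrite (_ : (M + n%:R * L * M * (d - c)) / 2 ^+ K =
    M / 2 ^+ K + n%:R * L * (M / 2 ^+ K) * (d - c)); last by ring.
  set E := M / 2 ^+ K => E0 hE h1 h2 h3.
  have h4 : n%:R * L * E * `|x - t0| <= n%:R * L * E * (d - c).
    exact: ler_wpM2l.
  have h5 := le_trans h3 h4; move: h1 h5; rewrite /f !ler_norml; lra.
apply: (@near_eq_is_derive _ _ _ (fun s => H s + (1%:M : 'M[R]_n) i j)).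
  near=> s; rewrite gH//; near: s; exact: open_nbhs_nbhs.
rewrite -[X in is_derive _ _ _ X]addr0; apply: is_deriveD.
exact: dH.
Unshelve. all: by end_near. Qed.

End LinearODE.

(** * The scalar product and the wedge product on so(n) *)

Section SkewAlgebra.
Context {R : realType} {n : nat}.
Implicit Types (X Y Z g : 'M[R]_n) (x y z : 'cV[R]_n).

Lemma dotvE x y : dotv x y = \sum_i x i 0 * y i 0.
Proof. by rewrite /dotv mxE; apply: eq_bigr => i _; rewrite mxE. Qed.

Lemma dotvC x y : dotv x y = dotv y x.
Proof. by rewrite !dotvE; apply: eq_bigr => i _; rewrite mulrC. Qed.

Lemma dotvDr x y z : dotv x (y + z) = dotv x y + dotv x z.
Proof. by rewrite /dotv mulmxDr mxE. Qed.

Lemma dotvDl x y z : dotv (y + z) x = dotv y x + dotv z x.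
Proof. by rewrite dotvC dotvDr !(dotvC x). Qed.

Lemma dotvNr x y : dotv x (- y) = - dotv x y.
Proof. by rewrite /dotv mulmxN mxE. Qed.

Lemma dotvNl x y : dotv (- y) x = - dotv y x.
Proof. by rewrite dotvC dotvNr dotvC. Qed.

Lemma dotvZr a x y : dotv x (a *: y) = a * dotv x y.
Proof. by rewrite /dotv -scalemxAr mxE. Qed.

Lemma dotvZl a x y : dotv (a *: y) x = a * dotv y x.
Proof. by rewrite dotvC dotvZr dotvC. Qed.

Definition dotv_lin := (dotvDr, dotvDl, dotvNr, dotvNl, dotvZr, dotvZl).

Lemma dotv_mulmx X x y : dotv x (X *m y) = dotv (X^T *m x) y.
Proof. by rewrite /dotv trmx_mul trmxK mulmxA. Qed.

Lemma mx11_dotv x y : x^T *m y = (dotv x y)%:M.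
Proof. exact: mx11_scalar. Qed.

Lemma wedgev_mul x y z : wedgev x y *m z = dotv y z *: x - dotv x z *: y.
Proof. by rewrite /wedgev mulmxBl -!mulmxA !mx11_dotv !mul_mx_scalar. Qed.

Lemma wedgevv x : wedgev x x = 0.
Proof. exact: subrr. Qed.

Lemma wedgevNl x y : wedgev (- x) y = wedgev y x.
Proof. by rewrite /wedgev mulNmx [(- x)^T]linearN mulmxN opprK addrC. Qed.

Lemma wedgevZr c x y : wedgev x (c *: y) = c *: wedgev x y.
Proof. by rewrite /wedgev [(c *: y)^T]linearZ/= -scalemxAr -scalemxAl scalerBr. Qed.

Lemma so_wedgev x y : so (wedgev x y).
Proof. by rewrite /so/= /wedgev linearB/= !trmx_mul !trmxK opprB. Qed.

Lemma soD X Y : so X -> so Y -> so (X + Y).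
Proof. by rewrite /so/= => hX hY; rewrite linearD/= hX hY opprD. Qed.

Lemma soN X : so X -> so (- X).
Proof. by rewrite /so/= => hX; rewrite linearN/= hX. Qed.

Lemma soZ a X : so X -> so (a *: X).
Proof. by rewrite /so/= => hX; rewrite linearZ/= hX scalerN. Qed.

Lemma so_commutator X Y : so X -> so Y -> so (X *m Y - Y *m X).
Proof.
rewrite /so/= => hX hY; rewrite linearB/= !trmx_mul hX hY.
by rewrite !mulNmx !mulmxN !opprK opprB.
Qed.

Lemma dotv_so X x y : so X -> dotv x (X *m y) = - dotv y (X *m x).
Proof. by move=> hX; rewrite dotv_mulmx hX mulNmx dotvNl dotvC. Qed.

Lemma dotv_so0 X x : so X -> dotv x (X *m x) = 0.
Proof. by move=> /dotv_so h; have := h x x; lra. Qed.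

Lemma pairingC X Y : pairing X Y = pairing Y X.
Proof. by rewrite /pairing mxtrace_mulC. Qed.

Lemma pairingDr X Y Z : pairing X (Y + Z) = pairing X Y + pairing X Z.
Proof. by rewrite /pairing mulmxDr mxtraceD; ring. Qed.

Lemma pairingDl X Y Z : pairing (Y + Z) X = pairing Y X + pairing Z X.
Proof. by rewrite pairingC pairingDr !(pairingC X). Qed.

Lemma pairingZr a X Y : pairing X (a *: Y) = a * pairing X Y.
Proof. by rewrite /pairing -scalemxAr mxtraceZ; ring. Qed.

Lemma pairingZl a X Y : pairing (a *: Y) X = a * pairing Y X.
Proof. by rewrite pairingC pairingZr pairingC. Qed.

Lemma pairingNr X Y : pairing X (- Y) = - pairing X Y.
Proof. by rewrite -scaleN1r pairingZr mulN1r. Qed.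

Lemma pairingNl X Y : pairing (- Y) X = - pairing Y X.
Proof. by rewrite pairingC pairingNr pairingC. Qed.

Definition pairing_lin :=
  (pairingDr, pairingDl, pairingNr, pairingNl, pairingZr, pairingZl).

(** Each half of the wedge contributes a trace of the form [dotv v (X *m u)]; skewness makes the two
    contributions equal, which absorbs the factor 1/2. *)
Lemma pairing_wedgev X x y : so X -> pairing X (wedgev x y) = dotv x (X *m y).
Proof.
move=> hX; have E u v : \tr (X *m (u *m v^T)) = dotv v (X *m u).
  by rewrite mulmxA mxtrace_mulC mx11_dotv mxtrace_scalar.
rewrite /pairing /wedgev mulmxBr linearB/= !E (dotv_so y) //; lra.
Qed.

(** On skew matrices the pairing is half the Frobenius product, so [pairing X X] is half a sum of
    squares. *)
Lemma pairing_eq0 X : so X -> pairing X X = 0 -> X = 0.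
Proof.
move=> hX; have -> : pairing X X = 2^-1 * \sum_i \sum_j X i j ^+ 2.
  rewrite /pairing -mulrN; congr (_ * _).
  have -> : - \tr (X *m X) = \tr (X^T *m X) by rewrite hX mulNmx linearN.
  rewrite /mxtrace; under eq_bigr do rewrite mxE.
  rewrite exchange_big/=; apply: eq_bigr => i _; apply: eq_bigr => j _.
  by rewrite mxE expr2.
move=> /eqP; rewrite mulf_eq0 invr_eq0 pnatr_eq0/=.
rewrite psumr_eq0 => [/allP h|i _]; last by apply: sumr_ge0 => j _; exact: sqr_ge0.
apply/matrixP => i j; rewrite mxE.
have := h i (mem_index_enum _); rewrite psumr_eq0 => [/allP h'|k _];
  last exact: sqr_ge0.
by have := h' j (mem_index_enum _); rewrite sqrf_eq0 => /eqP.
Qed.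

(** Invariance of the trace form under the adjoint action, from cyclicity of the trace. It moves the
    commutator from the variation to the momentum. *)
Lemma pairing_commutator X Y Z :
  pairing X (Y *m Z - Z *m Y) = pairing (Z *m X - X *m Z) Y.
Proof.
rewrite /pairing mulmxBr mulmxBl !raddfB/= -mulmxA (mxtrace_mulC Z) !mulmxA.
by congr (- (_ * (_ - _))); rewrite -mulmxA mxtrace_mulC mulmxA.
Qed.

(* [X = (X gamma) /\ gamma] expresses that [X] lies in v_gamma. *)
Lemma hspc_orthogonal (gamma : 'cV[R]_n) X : dotv gamma gamma = 1 -> so X ->
  (forall Z, hspc gamma Z -> pairing X Z = 0) <-> X = wedgev (X *m gamma) gamma.
Proof.
move=> g1 hX; split=> [H|-> Z [hZ ZP]]; last first.
  by rewrite pairingC; apply: ZP; exists (X *m gamma).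
(* [Z] is the h-component of [X]. It annihilates [gamma], hence lies in [hspc gamma], and it is
   orthogonal both to [X] and to the wedge, so [pairing Z Z] vanishes. *)
pose Z := X - wedgev (X *m gamma) gamma.
have hZ : so Z by apply/soD/soN/so_wedgev.
have Zg : Z *m gamma = 0.
  rewrite /Z mulmxBl wedgev_mul g1 scale1r (dotvC _ gamma) dotv_so0//.
  by rewrite scale0r subr0 subrr.
have ZP Y : vspc gamma Y -> pairing Z Y = 0.
  by move=> [x _ <-]; rewrite pairing_wedgev// Zg -[0](scale0r gamma) dotvZr mul0r.
apply/eqP; rewrite -subr_eq0 -/Z; apply/eqP/pairing_eq0 => //.
rewrite {1}/Z pairing_lin H; last by split.
by rewrite pairingNl pairingC ZP ?subr0//; exists (X *m gamma).
Qed.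

End SkewAlgebra.

(** * The constraint distribution and the Euler-Lagrange covector *)

Section Constraint.
Context {R : realType} {n : nat} (B : rubber_ball R n).
Local Notation a := (sradius B).
Local Notation eps := (epsilon B).
Local Notation s := (sgn B).
Implicit Types (q w : 'M[R]_n * 'cV[R]_n) (xi gamma : 'cV[R]_n).

Lemma sgn_sqr : s * s = 1.
Proof. by rewrite /sgn; case: (side B); rewrite /= ?mulr1 ?mulrNN ?mulr1. Qed.

Lemma sradius_neq0 : a != 0.
Proof.
rewrite /sradius /sgn; have := radii_compat B; have := rho_gt0 B.
have := sigma_gt0 B; case: (side B) => /= sg rh.
- by rewrite mul1r => _; rewrite gt_eqF// addr_gt0.
- by move=> h; rewrite mulN1r gt_eqF// subr_gt0.
- by move=> h; rewrite mulN1r lt_eqF// subr_lt0.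
Qed.

Lemma epsilon_neq0 : eps != 0.
Proof. by rewrite mulf_neq0 ?invr_eq0 ?sradius_neq0// gt_eqF// sigma_gt0. Qed.

(** Since [a = sigma + s * rho] and [a * eps = sigma]. The coefficient in the no-slip condition thus
    becomes [1 - eps]. *)
Lemma sgn_rho : s * rho B = a * (1 - eps).
Proof.
have a0 := sradius_neq0; rewrite /epsilon mulrBr mulr1 mulrCA mulfV// mulr1.
by rewrite /sradius addrC addKr.
Qed.

Lemma SO_orth (g : 'M[R]_n) : SO g -> [/\ g^T *m g = 1%:M, g *m g^T = 1%:M,
  g \in unitmx & invmx g = g^T].
Proof.
move=> [gg _]; have gg' := mulmx1C gg.
have gu : g \in unitmx by have [] := mulmx1_unit gg.
split=> //; by rewrite -[RHS]mulmx1 -(mulmxV gu) mulmxA gg mul1mx.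
Qed.

(** The admissible velocity at [(g, a *: (g *m gamma))] whose angular velocity sends [gamma] to
    [xi], for [xi] tangent at a unit vector [gamma]. *)
Definition wedge_velocity (g : 'M[R]_n) gamma xi : 'M[R]_n * 'cV[R]_n :=
  (g *m wedgev xi gamma, (s * rho B) *: (g *m xi)).

Lemma proj_sphereE q : configuration B q ->
  dotv (proj_sphere B q) (proj_sphere B q) = 1 /\
  q.2 = a *: (q.1 *m proj_sphere B q).
Proof.
move=> [/SO_orth[gg gg' _ gi] qr]; rewrite /proj_sphere gi.
have a0 := sradius_neq0; split; last first.
  by rewrite -scalemxAr scalerA mulfV// scale1r mulmxA gg' mul1mx.
rewrite !dotv_lin dotv_mulmx trmxK mulmxA gg' mul1mx.
by move: qr; rewrite /sphere/= => ->; field.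
Qed.

(** No twisting means that the angular velocity is X = (X gamma) /\ gamma, so [xi = X *m gamma]
    parametrizes the fibre. It is tangent because X is skew, and no slipping then fixes the velocity
    of the center. *)
Lemma constraint_distributionP q w : configuration B q ->
  constraint_distribution B q w <->
  exists2 xi, tangent_sphere (proj_sphere B q) xi &
    w = wedge_velocity q.1 (proj_sphere B q) xi.
Proof.
move=> qc; have [g1 rE] := proj_sphereE qc.
have [/SO_orth[gg gg' gu gi] _] := qc; have a0 := sradius_neq0.
have vel X ga : q.2 = a *: (q.1 *m ga) ->
    (s * (rho B / a)) *: (q.1 *m X *m invmx q.1 *m q.2) =
    (s * rho B) *: (q.1 *m (X *m ga)).
  move=> ->; rewrite -!mulmxA -scalemxAr mulKmx// -!scalemxAr scalerA.
  by congr (_ *: _); field.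
have {}vel X := vel X _ rE.
set ga := proj_sphere B q in g1 rE vel *.
split.
- case=> -[soX tw] w2 [_ X0].
  set X := angular_velocity q w in soX tw w2 X0.
  have XE : X = wedgev (X *m ga) ga.
    apply/(hspc_orthogonal g1 soX) => Z /X0; rewrite subr0; exact.
  exists (X *m ga); first by rewrite /tangent_sphere/= dotv_so0.
  rewrite [LHS]surjective_pairing w2 vel; congr (_, _).
  by rewrite -XE /X /angular_velocity mulKVmx.
- move=> [xi gxi ->]; rewrite /tangent_sphere/= in gxi.
  have XE : angular_velocity q (wedge_velocity q.1 ga xi) = wedgev xi ga.
    by rewrite /angular_velocity/= mulKmx.
  have Xg : wedgev xi ga *m ga = xi.
    by rewrite wedgev_mul g1 scale1r dotvC gxi scale0r subr0.
  split; rewrite ?XE.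
  - split; rewrite ?XE; first exact: so_wedgev.
    rewrite /tangent_sphere/= rE !dotv_lin dotv_mulmx mulmxA gg mul1mx gxi.
    by rewrite !mulr0.
  - by rewrite vel Xg.
  - split.
      split; first by rewrite /so/= trmx0 oppr0.
      by move=> Y _; rewrite /pairing mul0mx mxtrace0 mulr0 oppr0.
    move=> Z hZ; rewrite subr0; move: Z hZ.
    by apply/(hspc_orthogonal g1 (so_wedgev _ _)); rewrite Xg.
Qed.

(** The two pairings are not merged: [v] and [w] are arbitrary, while the inertia operator is
    symmetric only on so(n). *)
Lemma is_derive_lagrangian_velocity q v w :
  is_derive v w (lagrangian B q)
    (2^-1 * (pairing (inertia B (invmx q.1 *m w.1)) (invmx q.1 *m v.1) +
             pairing (inertia B (invmx q.1 *m v.1)) (invmx q.1 *m w.1))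
     + mass B * dotv v.2 w.2).
Proof.
have h0 := is_derive_id v w.
have h1 := is_derive_mulmx (is_derive_cst (invmx q.1) v w) (is_derive_fst h0).
have h2 := is_derive_snd h0.
have h3 := is_derive_pairing (is_derive_linear_mx (inertia B) h1) h1.
have h4 := is_derive_dotv h2 h2.
apply: (is_derive_eq (is_deriveD (is_deriveZ 2^-1 h3) (is_deriveZ (2^-1 * mass B) h4))).
rewrite mul0mx add0r /= (dotvC w.2); congr (_ + _).
rewrite -[LHS]/(2^-1 * mass B * (dotv v.2 w.2 + dotv v.2 w.2)); lra.
Qed.

(** Only the rotation enters through the position; varying it by [w.1] with [v] fixed changes the
    angular velocity [X] by [- (Y *m X)]. *)
Lemma is_derive_lagrangian_position q v w : q.1 \in unitmx ->
  is_derive q w (fun x => lagrangian B x v)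
    (let X := invmx q.1 *m v.1 in let Y := invmx q.1 *m w.1 in
     - (2^-1 * (pairing (inertia B (Y *m X)) X +
                pairing (inertia B X) (Y *m X)))).
Proof.
move=> qu; have h0 := is_derive_id q w.
have h1 := is_derive_mulmx (is_derive_invmx (is_derive_fst h0) qu)
  (is_derive_cst v.1 q w).
have h3 := is_derive_pairing (is_derive_linear_mx (inertia B) h1) h1.
have h4 := is_derive_cst (2^-1 * mass B * dotv v.2 v.2) q w.
apply: (is_derive_eq (is_deriveD (is_deriveZ 2^-1 h3) h4)).
rewrite mulmx0 !addr0 /= mulNmx linearN !pairing_lin -!mulmxA.
by rewrite -[LHS]/(2^-1 * _) -opprD mulrN.
Qed.

Lemma modified_inertia_mul (X : 'M[R]_n) xi : modified_inertia B X *m xi =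
  inertia B X *m xi + (mass B * rho B ^+ 2) *: (X *m xi).
Proof. by rewrite /modified_inertia mulmxDl -scalemxAl. Qed.

(** The multiple of the identity in the modified inertia contributes only through (g /\ u) g = (g,
    u) g - u, because (g /\ v) v = (v, v) g is orthogonal to [xi]. The weights [eps] and [1 - eps]
    of the remaining velocity terms add up to 1. *)
Lemma reduced_covectorE (g v u xi : 'cV[R]_n) :
  dotv g g = 1 -> dotv g v = 0 -> dotv g xi = 0 ->
  dotv (eps *: (modified_inertia B (wedgev g u) *m g +
                modified_inertia B (wedgev g v) *m v)
        + (1 - eps) *: (modified_inertia B (wedgev g v) *m v)) xi =
  eps * dotv xi (inertia B (wedgev g u) *m g)
  + dotv xi (inertia B (wedgev g v) *m v)
  - eps * (mass B * rho B ^+ 2) * dotv xi u.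
Proof.
move=> gg gv gxi.
have Wv := wedgev_mul g v v; have Wg := wedgev_mul g u g.
move: (wedgev g v) (wedgev g u) Wv Wg => W W' Wv Wg.
rewrite dotvC !modified_inertia_mul Wv Wg !dotv_lin (dotvC xi g) gxi gv gg; ring.
Qed.

(* [X *m E] and [E *m X] are not in so(n), where the inertia operator is
   arbitrary; only their difference is. *)
Lemma inertia_covector (X Y E : 'M[R]_n) : so X -> so Y -> so E ->
  2^-1 * (pairing (inertia B (- (X *m E))) X + pairing (inertia B E) Y +
          (pairing (inertia B Y) E + pairing (inertia B X) (- (X *m E)))) +
  2^-1 * (pairing (inertia B (E *m X)) X + pairing (inertia B X) (E *m X)) =
  pairing (inertia B Y + (X *m inertia B X - inertia B X *m X)) E.
Proof.
move=> hX hY hE; have hK := so_commutator hE hX.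
rewrite [RHS]pairingDl -pairing_commutator linearN.
have h1 : pairing (inertia B E) Y = pairing (inertia B Y) E.
  by rewrite inertia_sym// pairingC.
have h2 : pairing (inertia B (E *m X)) X - pairing (inertia B (X *m E)) X =
    pairing (inertia B X) (E *m X) - pairing (inertia B X) (X *m E).
  have : pairing (inertia B (E *m X - X *m E)) X =
      pairing (inertia B X) (E *m X - X *m E).
    by rewrite inertia_sym// pairingC.
  by rewrite linearB/= pairingDl pairingNl pairingDr pairingNr.
rewrite pairingNl pairingDr !pairingNr h1.
move: h2; set x := pairing (inertia B _) X; set y := pairing (inertia B _) X; lra.
Qed.

(** Pairing with xi /\ g evaluates at [g]. With W = g /\ v and A the inertia of W, one has W g = -
    v, so - A W g = A v. The other half of the commutator, W A g = (v, A g) g - (g, A g) v, drops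
    out: [g] is orthogonal to [xi], and (g, A g) = 0 by skewness. *)
Lemma inertia_covector_wedge (g v u xi : 'cV[R]_n) (e : R) :
  dotv g g = 1 -> dotv g v = 0 -> dotv g xi = 0 ->
  let X := e *: wedgev g v in
  pairing (inertia B (e *: wedgev g u) + (X *m inertia B X - inertia B X *m X))
    (wedgev xi g) =
  e * dotv xi (inertia B (wedgev g u) *m g) +
  e ^+ 2 * dotv xi (inertia B (wedgev g v) *m v).
Proof.
move=> gg gv gxi /=.
have IZ Z : inertia B (e *: Z) = e *: inertia B Z by exact: linearZ.
rewrite !IZ.
have hW : so (inertia B (wedgev g v)) by apply/inertia_so/so_wedgev.
have hW' : so (inertia B (wedgev g u)) by apply/inertia_so/so_wedgev.
have Wg := wedgev_mul g v g; rewrite gg (dotvC v) gv scale0r scale1r sub0r in Wg.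
have WA z := wedgev_mul g v z.
have sW := so_wedgev g v.
move: (wedgev g v) (inertia B (wedgev g v)) (inertia B (wedgev g u)) hW hW' Wg WA sW.
move=> W A A' hA hA' Wg WA sW.
rewrite pairing_wedgev; last first.
  by apply: soD; [exact: soZ|apply: so_commutator; exact: soZ].
rewrite !mulmxDl mulNmx -!(scalemxAl, scalemxAr) -!mulmxA Wg WA.
rewrite mulmxN !dotv_lin (dotv_so0 _ hA) (dotvC xi g) gxi; ring.
Qed.

(** The first argument is the acceleration of the center. Its term with (gam /\ v) v is radial,
    hence orthogonal to [xi], and the rotation [g] preserves scalar products. *)
Lemma mass_covector (g : 'M[R]_n) (gam v u xi : 'cV[R]_n) (c d e : R) :
  g^T *m g = 1%:M -> dotv gam v = 0 -> dotv gam xi = 0 ->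
  dotv (c *: (g *m (e *: wedgev gam v) *m v + g *m u)) (d *: (g *m xi)) =
  c * d * dotv xi u.
Proof.
move=> gg gv gxi; rewrite -mulmxA -mulmxDr !(dotvZr, dotvZl) dotv_mulmx mulmxA gg.
rewrite mul1mx -scalemxAl wedgev_mul gv scale0r subr0 !dotv_lin (dotvC u) gxi; ring.
Qed.

Lemma is_derive_modified_inertia (V : normedModType R) (X : V -> 'M[R]_n) t v dX :
  is_derive t v X dX ->
  is_derive t v (fun u => modified_inertia B (X u)) (modified_inertia B dX).
Proof.
by move=> hX; apply: is_deriveD; exact: is_derive_linear_mx.
Qed.

End Constraint.

(** * Horizontal lifts of curves on the sphere *)

Section Reduction.
Context {R : realType} {n : nat} (B : rubber_ball R n).
Context {J : set R} {gamma : R -> 'cV[R]_n}.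
Context (Jopen : open J) (Jitv : is_interval J).
Context (gamma_diff : twice_derivable J gamma).
Context (gamma_sphere : forall t, J t -> sphere 1 (gamma t)).
Local Notation a := (sradius B).
Local Notation eps := (epsilon B).
Local Notation s := (sgn B).
Local Notation dgamma := (derive1 gamma).
Local Notation ddgamma := (derive1 dgamma).

Definition lift_velocity (t : R) : 'M[R]_n := eps^-1 *: wedgev (gamma t) (dgamma t).

Definition horizontal_lift (q : R -> 'M[R]_n * 'cV[R]_n) := forall t, J t ->
  [/\ configuration B (q t), proj_sphere B (q t) = gamma t &
      is_derive t 1 q ((q t).1 *m lift_velocity t,
                       (- (s * rho B / eps)) *: ((q t).1 *m dgamma t))].

Lemma nearJ (t : R) : J t -> \forall u \near t, J u.
Proof. by move=> Jt; exact: open_nbhs_nbhs. Qed.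

Lemma derive1_val (W : normedModType R) (f : R -> W) (t : R) df :
  is_derive t 1 f df -> derive1 f t = df.
Proof. by move=> [_ <-]; rewrite derive1E. Qed.

Lemma is_derive_derive1 (W : normedModType R) (f : R -> W) (t : R) :
  derivable f t 1 -> is_derive t 1 f (derive1 f t).
Proof. by move=> d; rewrite derive1E; exact: derivableP. Qed.

Lemma is_derive_gamma t : J t -> is_derive t 1 gamma (dgamma t).
Proof. by move=> /gamma_diff[d _]; exact: is_derive_derive1. Qed.

Lemma is_derive_dgamma t : J t -> is_derive t 1 dgamma (ddgamma t).
Proof. by move=> /gamma_diff[_ d]; exact: is_derive_derive1. Qed.

Lemma dotv_gamma t : J t -> dotv (gamma t) (gamma t) = 1.
Proof. by move=> /gamma_sphere; rewrite /sphere/= expr1n. Qed.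

Lemma dotv_gamma_dgamma t : J t -> dotv (gamma t) (dgamma t) = 0.
Proof.
move=> Jt; have dg := is_derive_gamma Jt.
have h1 := is_derive_dotv dg dg.
have h2 : is_derive t 1 (fun u => dotv (gamma u) (gamma u)) 0.
  apply: (near_eq_is_derive _ (is_derive_cst (1 : R) t 1)).
  by near=> u; rewrite dotv_gamma//; near: u; exact: nearJ.
have := derive1_val h1; rewrite (derive1_val h2) (dotvC (dgamma t)).
by move=> e; lra.
Unshelve. all: by end_near. Qed.

Lemma lift_velocity_gamma t : J t ->
  lift_velocity t *m gamma t = - (eps^-1 *: dgamma t).
Proof.
move=> Jt; rewrite /lift_velocity -scalemxAl wedgev_mul dotv_gamma//.
by rewrite dotvC dotv_gamma_dgamma// scale0r scale1r sub0r scalerN.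
Qed.

Lemma is_derive_wedge_gamma t : J t ->
  is_derive t 1 (fun u => wedgev (gamma u) (dgamma u)) (wedgev (gamma t) (ddgamma t)).
Proof.
move=> Jt; have h := is_derive_wedgev (is_derive_gamma Jt) (is_derive_dgamma Jt).
apply: (is_derive_eq h).
by rewrite wedgevv add0r.
Qed.

Lemma is_derive_lift_velocity t : J t ->
  is_derive t 1 lift_velocity (eps^-1 *: wedgev (gamma t) (ddgamma t)).
Proof. by move=> Jt; apply: is_deriveZ; exact: is_derive_wedge_gamma. Qed.

(** The velocity of a lift is the admissible vector with parameter - gamma' / epsilon, which makes
    [constraint_distributionP] applicable. *)
Lemma lift_derivative (g : 'M[R]_n) t :
  (g *m lift_velocity t, (- (s * rho B / eps)) *: (g *m dgamma t)) =
  wedge_velocity B g (gamma t) (- (eps^-1 *: dgamma t)).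
Proof.
rewrite /wedge_velocity /lift_velocity; congr (_ *m _, _).
  by rewrite wedgevNl wedgevZr.
by rewrite mulmxN -scalemxAr scalerN scalerA scaleNr.
Qed.

Lemma motion_horizontal_lift q : motion B J q ->
  (forall t, J t -> proj_sphere B (q t) = gamma t) -> horizontal_lift q.
Proof.
move=> [q2 qm] qg t Jt; have [qc qd _] := qm t Jt.
split => //; first exact: qg.
have dq := is_derive_derive1 (q2 t Jt).1.
move/(constraint_distributionP _ qc) : qd => [xi xig qE].
have [/SO_orth[gg gg' gu gi] _] := qc.
have [_ rE] := proj_sphereE qc.
rewrite qg// in rE xig qE; rewrite /tangent_sphere/= in xig.
have a0 := sradius_neq0 B; have e0 := epsilon_neq0 B.
have h1 := is_derive_mulmx (is_derive_invmx (is_derive_fst dq) gu) (is_derive_snd dq).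
have h2 := is_derive_scalel a^-1 h1.
(* Differentiating gamma = g^-1 r / a gives two multiples of [xi]: -1 from the rotation and
   [1 - eps] from the motion of the center. Hence the parameter [xi] is determined by gamma'. *)
have h3 : is_derive t 1 gamma (- (eps *: xi)).
  apply: (@near_eq_is_derive _ _ _ (fun u => proj_sphere B (q u))).
    by near=> u; rewrite qg//; near: u; exact: nearJ.
  apply: (is_derive_eq h2).
  rewrite qE /wedge_velocity/= mulKmx// -scalemxAr mulKmx// rE.
  rewrite mulNmx -mulmxA -[in X in X + _]scalemxAr mulKmx// -scalemxAr.
  rewrite wedgev_mul dotv_gamma// scale1r dotvC xig scale0r subr0.
  rewrite -[- (a *: xi)]scaleNr -[- (eps *: xi)]scaleNr -scalerDl scalerA.
  rewrite sgn_rho; congr (_ *: _).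
  by rewrite mulrBr mulr1 addKr mulrN mulKf.
apply: (is_derive_eq dq).
rewrite lift_derivative qE (derive1_val h3); congr (wedge_velocity _ _ _ _).
by rewrite scalerN opprK scalerA mulVf// scale1r.
Unshelve. all: by end_near. Qed.

Lemma horizontal_lift_twice_derivable q : horizontal_lift q -> twice_derivable J q.
Proof.
move=> ql t Jt; have [_ _ dq] := ql t Jt; split; first by case: dq.
have dg := is_derive_fst dq.
have h := is_derive_pair (is_derive_mulmx dg (is_derive_lift_velocity Jt))
  (is_derive_scalel (- (s * rho B / eps)) (is_derive_mulmx dg (is_derive_dgamma Jt))).
apply: (@near_eq_derivable _ _ _ _ _ _ _ _ (@ex_derive _ _ _ _ _ _ _ h)).
near=> u; have Ju : J u by near: u; exact: nearJ.
by have [_ _ /derive1_val ->] := ql u Ju.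
Unshelve. all: by end_near. Qed.

Lemma reduced_covector t xi : J t -> dotv (gamma t) xi = 0 ->
  dotv (eps *: derive1 (fun u =>
      modified_inertia B (wedgev (gamma u) (dgamma u)) *m gamma u) t
    + (1 - eps) *: (modified_inertia B (wedgev (gamma t) (dgamma t)) *m dgamma t)) xi =
  eps * dotv xi (inertia B (wedgev (gamma t) (ddgamma t)) *m gamma t)
  + dotv xi (inertia B (wedgev (gamma t) (dgamma t)) *m dgamma t)
  - eps * (mass B * rho B ^+ 2) * dotv xi (ddgamma t).
Proof.
move=> Jt gxi; have hW := is_derive_wedge_gamma Jt.
have hM := is_derive_modified_inertia B hW.
rewrite (derive1_val (is_derive_mulmx hM (is_derive_gamma Jt))).
by rewrite reduced_covectorE ?dotv_gamma ?dotv_gamma_dgamma.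
Qed.

(** Along a lift the momenta are explicit in g, gamma and gamma', so the covector can be computed
    and compared with the expansion in [reduced_covector]. *)
Lemma euler_lagrange_lift q t xi : horizontal_lift q -> J t ->
  dotv (gamma t) xi = 0 ->
  euler_lagrange (lagrangian B) q t (wedge_velocity B (q t).1 (gamma t) xi) =
  eps ^- 2 * dotv
    (eps *: derive1 (fun u =>
       modified_inertia B (wedgev (gamma u) (dgamma u)) *m gamma u) t
    + (1 - eps) *: (modified_inertia B (wedgev (gamma t) (dgamma t)) *m dgamma t)) xi.
Proof.
move=> ql Jt gxi; rewrite reduced_covector//.
have [[/SO_orth[gg gg' gu gi] _] _ dq] := ql t Jt.
set w := wedge_velocity _ _ _ _.
set Om := lift_velocity t; set eta := wedgev xi (gamma t).
pose Om' : 'M[R]_n := eps^-1 *: wedgev (gamma t) (ddgamma t).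
have e0 := epsilon_neq0 B.
have soOm : so Om by apply/soZ/so_wedgev.
have soOm' : so Om' by apply/soZ/so_wedgev.
have soeta : so eta by exact: so_wedgev.
have dg := is_derive_fst dq; rewrite /= -/Om in dg.
(* The test vector [w] is constant in the ambient space, so its body representation moves with the
   frame. This yields one half of the commutator; the position derivative of the Lagrangian yields
   the other. *)
have hb : is_derive t 1 (fun u => invmx (q u).1 *m w.1) (- (Om *m eta)).
  have h := is_derive_mulmx (is_derive_invmx dg gu) (is_derive_cst w.1 t 1).
  apply: (is_derive_eq h).
  by rewrite mulmx0 addr0 /= mulKmx// mulNmx -!mulmxA mulKmx.
have hOm := is_derive_lift_velocity Jt; rewrite -/Om' in hOm.
have h1 := is_deriveD (is_derive_pairing (is_derive_linear_mx (inertia B) hb) hOm)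
  (is_derive_pairing (is_derive_linear_mx (inertia B) hOm) hb).
have h2 := is_derive_dotv (is_derive_scalel (- (s * rho B / eps))
  (is_derive_mulmx dg (is_derive_dgamma Jt))) (is_derive_cst w.2 t 1).
have hF := is_deriveD (is_derive_scalel (2^-1 : R) h1) (is_derive_scalel (mass B) h2).
rewrite /euler_lagrange.
have -> : derive1 (fun u => 'D_w (lagrangian B (q u)) (derive1 q u)) t =
  'D_1 (fun u => 'D_w (lagrangian B (q u)) (derive1 q u)) t by rewrite derive1E.
have hF' := near_eq_is_derive _ hF.
(* The explicit momentum formula is available only for times in [J], hence near [t], which suffices
   for the derivative. *)
rewrite (@derive_val _ _ _ _ _ _ _ (hF' _ _)); last first.
  near=> u; have Ju : J u by near: u; exact: nearJ.
  have [[/SO_orth[_ _ guu _] _] _ /derive1_val ->] := ql u Ju.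
  rewrite (@derive_val _ _ _ _ _ _ _ (is_derive_lagrangian_velocity B _ _ _)) /=.
  by rewrite mulKmx.
have hq := is_derive_lagrangian_position B (derive1 q t) w gu.
rewrite (@derive_val _ _ _ _ _ _ _ hq).
rewrite (derive1_val dq) /= -/Om !mulKmx// -/eta.
have gg1 := dotv_gamma Jt; have gv := dotv_gamma_dgamma Jt.
rewrite (mass_covector _ _ _ _ gg gv gxi).
have -> y : dotv y 0 = 0 by rewrite /dotv mulmx0 mxE.
rewrite addr0 opprK addrAC [X in X + _](inertia_covector B soOm soOm' soeta).
rewrite (inertia_covector_wedge B _ _ gg1 gv gxi) -[mass B *: _]/(mass B * _).
(* The sign of the rolling case enters only squared, so all cases give the same mass term. *)
have -> : - (s * rho B / eps) * (s * rho B) = - (s * s * rho B ^+ 2 / eps) by ring.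
rewrite sgn_sqr mul1r; move: (eps) e0 => e e0; by field.
Unshelve. all: by end_near. Qed.

(** For skew velocity Om, the derivative g (Om + Om^T) g^T of g g^T vanishes, so g stays orthogonal.
    Its determinant is then 1 or -1, and continuity keeps it at 1. *)
Lemma lift_connection_so (g : R -> 'M[R]_n) (t0 : R) : J t0 -> g t0 = 1%:M ->
  (forall t, J t -> is_derive t 1 g (g t *m lift_velocity t)) ->
  forall t, J t -> SO (g t).
Proof.
move=> Jt0 g0 dg.
have orth t : J t -> (g t)^T *m g t = 1%:M.
  move=> Jt; apply: mulmx1C.
  pose K u := g u *m (g u)^T.
  have dK u : J u -> is_derive u 1 K 0.
    move=> Ju; have h := is_derive_mulmx (dg u Ju) (is_derive_trmx (dg u Ju)).
    apply: (is_derive_eq h).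
    have soOm : so (lift_velocity u) by apply/soZ/so_wedgev.
    by rewrite trmx_mul soOm mulNmx mulmxN mulmxA subrr.
  have -> : 1%:M = K t0 by rewrite /K g0 trmx1 mulmx1.
  apply/matrixP => i j.
  apply: (@constant_on_interval _ _ Jitv (fun u => K u i j) _ _ Jt0 Jt) => u /dK.
  by move=> /is_derive_mxP /(_ i j); rewrite mxE.
move=> t Jt; split; first exact: orth.
have dc u : J u -> {for u, continuous (fun u => \det (g u))}.
  by move=> /dg[d _]; exact/derivable_continuous/derivable_det.
have det2 u : J u -> \det (g u) ^+ 2 = 1.
  by move=> /orth /(congr1 determinant); rewrite det_mulmx det_tr det1 expr2.
have : \det (g t) = 1 \/ \det (g t) = -1.
  by have /eqP := det2 t Jt; rewrite sqrf_eq1 => /orP[] /eqP ->; [left|right].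
case=> // dt.
(* A determinant -1 at [t] and 1 at [t0] would force a zero in between, contradicting [det2]. *)
have [u Ju du] : exists2 u, J u & \det (g u) = 0.
  apply: (interval_IVT Jitv dc Jt Jt0).
  by rewrite dt g0 det1 lerN10 ler01.
by have := det2 u Ju; rewrite du expr0n/= => /eqP; rewrite eq_sym oner_eq0.
Qed.

Lemma horizontal_lift_exists : exists q, horizontal_lift q.
Proof.
have [[t0 Jt0]|J0] := pselect (exists t, J t); last first.
  by exists (fun=> 0) => t Jt; case: J0; exists t.
have [|g [g0 dg]] := linear_ode Jopen Jitv Jt0 (om := lift_velocity).
  move=> i j t Jt; have /is_derive_mxP/(_ i j)[d _] := is_derive_lift_velocity Jt.
  exact: derivable_continuous.
have gSO := lift_connection_so Jt0 g0 dg.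
have a0 := sradius_neq0 B.
exists (fun t => (g t, a *: (g t *m gamma t))) => t Jt.
have [gg gg' gu gi] := SO_orth (gSO t Jt); split.
- split; first exact: gSO.
  rewrite /sphere/= dotvZl dotvZr dotv_mulmx mulmxA gg mul1mx dotv_gamma//.
  by rewrite mulr1 expr2.
- by rewrite /proj_sphere/= -scalemxAr mulKmx// scalerA mulVf// scale1r.
- apply: is_derive_pair; first exact: dg.
  have h := is_derive_mulmx (dg t Jt) (is_derive_gamma Jt).
  (* The center is defined from g and gamma, so its velocity must be checked: it is a (1 - 1 / eps)
     g gamma', and [sgn_rho] turns the coefficient into - s rho / eps. *)
  apply: (is_derive_eq (is_derive_scalel a h)).
  rewrite -mulmxA lift_velocity_gamma// -mulmxDr -scaleNr.
  rewrite -[X in _ + X]scale1r -scalerDl.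
  rewrite -scalemxAr scalerA sgn_rho; congr (_ *: _).
  move: (eps) (epsilon_neq0 B) => e e0; by field.
Qed.

End Reduction.

Theorem theorem8 (R : realType) (n : nat) (B : rubber_ball R n)
    (J : set R) (gamma : R -> 'cV[R]_n)
    (Jopen : open J) (Jitv : is_interval J)
    (gamma_diff : twice_derivable J gamma)
    (gamma_sphere : forall t, J t -> sphere 1 (gamma t)) :
  reduced_motion B J gamma <->
  forall t, J t -> forall xi, tangent_sphere (gamma t) xi ->
    dotv
      (epsilon B *:
         derive1 (fun s => modified_inertia B (wedgev (gamma s) (derive1 gamma s))
                            *m gamma s) t
       + (1 - epsilon B) *:
         (modified_inertia B (wedgev (gamma t) (derive1 gamma t))
            *m derive1 gamma t))
      xi = 0.
Proof.
split=> [[q qm qg] t Jt xi xig|H].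
  have ql := motion_horizontal_lift Jopen gamma_sphere qm qg.
  have [qc pq _] := ql t Jt; have [_ /(_ t Jt)[_ _ EL]] := qm.
  have /EL/eqP : constraint_distribution B (q t)
      (wedge_velocity B (q t).1 (gamma t) xi).
    by apply/(constraint_distributionP _ qc); exists xi; rewrite pq.
  rewrite (euler_lagrange_lift Jopen gamma_diff gamma_sphere ql Jt xig).
  by rewrite mulf_eq0 invr_eq0 expf_eq0/= (negPf (epsilon_neq0 B)) => /eqP.
have [q ql] := horizontal_lift_exists B Jopen Jitv gamma_diff gamma_sphere.
exists q; last by move=> t /ql[].
split; first exact: (horizontal_lift_twice_derivable Jopen gamma_diff ql).
move=> t Jt; have [qc pq dq] := ql t Jt; split => //.
- apply/(constraint_distributionP _ qc); rewrite pq.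
  (* The parameter supplied by [lift_derivative]. *)
  exists (- ((epsilon B)^-1 *: derive1 gamma t)).
    have gv := dotv_gamma_dgamma Jopen gamma_diff gamma_sphere Jt.
    by rewrite /tangent_sphere/= dotvNr dotvZr gv mulr0 oppr0.
  by rewrite (derive1_val dq) lift_derivative.
- move=> w /(constraint_distributionP _ qc); rewrite pq => -[xi xig ->].
  rewrite (euler_lagrange_lift Jopen gamma_diff gamma_sphere ql Jt xig).
  by rewrite H// mulr0.
Qed.
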